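(* Let $V$ be a complex projective subvariety of $\mathbb{P}^n(\mathbb{C})$ of dimension $k$ $(k\le n)$. Let $Q_1,\dots,Q_q$ be $q$ $(q>2N-k+1)$ hypersurfaces in $\mathbb{P}^n(\mathbb{C})$ in $N$-subgeneral position with respect to $V$, of the common degree $d$. Then there are positive rational constants $\omega_i$ $(1\le i\le q)$ satisfying the following: i) $0<\omega_i\le1$ for all $i\in\{1,\dots,q\}$. ii) Setting $\tilde\omega=\max_{1\le j\le q}\omega_j$, one gets $$\sum_{j=1}^q\omega_j=\tilde\omega(q-2N+k-1)+k+1.$$ iii) $\dfrac{k+1}{2N-k+1}\le\tilde\omega\le\dfrac{k}{N}$. iv) For $R\subset\{1,\dots,q\}$ with $\sharp R=N+1$, $\sum_{i\in R}\omega_i\le k+1$. v) Let $E_i\ge1$ $(1\le i\le q)$ be arbitrarily given numbers. For $R\subset\{1,\dots,q\}$ with $\sharp R=N+1$, there is a subset $R^o\subset R$ such that $\sharp R^o=\mathrm{rank}\{Q_i\}_{i\in R^o}=k+1$ and $$\prod_{i\in R}E_i^{\omega_i}\le\prod_{i\in R^o}E_i.$$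
   Context: Hypersurfaces are identified with defining homogeneous polynomials in $\mathbb{C}[x_0,\dots,x_n]$. Subgeneral position: a family $\{Q_i\}_{i=1}^q$ $(q\ge k+1)$ of hypersurfaces in $\mathbb{P}^n(\mathbb{C})$ is in $N$-subgeneral position with respect to $V$ if $V\cap\bigcap_{j=1}^{N+1}Q_{i_j}=\varnothing$ for all $1\le i_1<\cdots<i_{N+1}\le q$. Rank: $I(V)$ is the ideal of homogeneous polynomials in $\mathbb{C}[x_0,\dots,x_n]$ defining $V$, $H_d$ is the $\mathbb{C}$-vector space of homogeneous polynomials of degree $d$ in $\mathbb{C}[x_0,\dots,x_n]$, and $I_d(V)=H_d/(I(V)\cap H_d)$. For hypersurfaces $Q_i$ $(i\in R)$ of degree $d$, $\mathrm{rank}\{Q_i\}_{i\in R}$ is the dimension of the $\mathbb{C}$-linear span of the classes $[Q_i]$ $(i\in R)$ in $I_d(V)$. $\sharp R$ is the cardinality of $R$.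
   Formalization: It is assumed that k≥1 (for k=0 the bounds in iii) contradict each other or read 0/0), that d≥1 and each Q_i is nonzero, and that no Q_i contains V (otherwise [Q_i]=0 and v) fails for R containing i when E_i is large and all other E_j=1). *)

(* Defs.v *)
From HB Require Import structures.
From mathcomp Require Import all_boot all_order all_algebra.
From mathcomp Require Import generic_quotient ring_quotient.
From mathcomp Require Import boolp classical_sets.
From mathcomp Require Import mpoly.

Set Implicit Arguments.
Unset Strict Implicit.
Unset Printing Implicit Defensive.

Import GRing.Theory.

Local Open Scope ring_scope.
Local Open Scope quotient_scope.
Local Open Scope classical_set_scope.

(* [ring_quotient] only makes {quot U} a Z-module; the quotient of a
   finite-dimensional vector space by a linear subspace U is made a vectType,
   so that \dim and <<_>> are available in it. *)
Section VectQuotient.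
Variables (F : fieldType) (vT : vectType F) (U : {vspace vT}).

Definition vquot : Type := Quotient.quot U.

HB.instance Definition _ := GRing.Zmodule.on vquot.
HB.instance Definition _ := EqQuotient.on vquot.

Definition vquot_class (v : vT) : vquot := \pi_vquot v.

Definition vquot_scale (a : F) (x : vquot) : vquot := vquot_class (a *: repr x).

Lemma vquot_eqP (v w : vT) : (vquot_class v = vquot_class w) <-> (v - w \in U).
Proof. by rewrite (Quotient.idealrBE U); split=> /eqP. Qed.

Lemma vquot_classD v w : vquot_class (v + w) = vquot_class v + vquot_class w.
Proof. exact: (Quotient.pi_add U v w). Qed.

Lemma vquot_reprK (x : vquot) : vquot_class (repr x) = x.
Proof. exact: reprK. Qed.

Lemma vquot_classZ a v : vquot_class (a *: v) = vquot_scale a (vquot_class v).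
Proof.
rewrite /vquot_scale; apply/vquot_eqP; rewrite -scalerBr; apply: rpredZ.
by apply/vquot_eqP; rewrite vquot_reprK.
Qed.

Fact vquot_scaleA a b x : vquot_scale a (vquot_scale b x) = vquot_scale (a * b) x.
Proof. by rewrite -(vquot_reprK x) -!vquot_classZ scalerA. Qed.

Fact vquot_scale1 : left_id 1 vquot_scale.
Proof. by move=> x; rewrite -(vquot_reprK x) -!vquot_classZ scale1r. Qed.

Fact vquot_scaleDr : right_distributive vquot_scale +%R.
Proof.
move=> a x y; rewrite -(vquot_reprK x) -(vquot_reprK y).
by rewrite -vquot_classD -!vquot_classZ -vquot_classD scalerDr.
Qed.

Fact vquot_scaleDl x : {morph vquot_scale^~ x : a b / a + b}.
Proof.
by move=> a b; rewrite -(vquot_reprK x) -!vquot_classZ -vquot_classD scalerDl.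
Qed.

HB.instance Definition _ := GRing.Zmodule_isLmodule.Build F vquot
  vquot_scaleA vquot_scale1 vquot_scaleDr vquot_scaleDl.

Fact vquot_class_is_linear : linear vquot_class.
Proof. by move=> a v w; rewrite vquot_classD vquot_classZ. Qed.

HB.instance Definition _ :=
  GRing.isLinear.Build F vT vquot _ vquot_class vquot_class_is_linear.

Import VectorInternalTheory.

Fact vquot_findim : {n : nat & Vector.axiom n vquot}.
Proof.
pose g (x : subvs_of (U^C)%VS) : vquot := vquot_class (vsval x).
have g_lin : linear g by move=> a x y; rewrite /g !linearP.
have g_inj : injective g.
  move=> x y /vquot_eqP xyU; apply/val_inj/eqP.
  rewrite -subr_eq0 -memv0 -(capv_compl U) memv_cap xyU /=.
  by rewrite rpredB // subvsP.
have g_surj (z : vquot) : exists x, g x = z.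
  have : repr z \in (U + U^C)%VS by rewrite addv_complf memvf.
  case/memv_addP=> u uU [w wU zE]; exists (vsproj (U^C)%VS w).
  rewrite /g vsprojK // -[RHS]vquot_reprK; apply/vquot_eqP.
  by rewrite zE opprD addrCA subrr addr0 rpredN.
pose h z := sval (cid (g_surj z)).
have hK : cancel h g by move=> z; rewrite /h; case: cid.
have gK : cancel g h by move=> x; apply: g_inj; rewrite hK.
exists (dim (subvs_of (U^C)%VS)), (fun z => v2r (h z)).
  move=> a x y; rewrite -linearP; congr v2r.
  by apply: g_inj; rewrite g_lin !hK.
exists (fun r => g (r2v r)) => [z|r]; first by rewrite v2rK hK.
by rewrite gK r2vK.
Qed.

HB.instance Definition _ :=
  Lmodule_hasFinDim.Build F vquot (projT2 vquot_findim).

End VectQuotient.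

Lemma submod_vspace (F : fieldType) (vT : vectType F) (P : {pred vT}) :
  submod_closed P -> exists U : {vspace vT}, forall v, (v \in U) = (v \in P).
Proof.
move=> Pcl; have [P0 PD PZ] : [/\ 0 \in P, {in P &, forall u v, u + v \in P}
    & forall a, {in P, forall u, a *: u \in P}].
  case: Pcl => P0 PL; split=> // [u v uP vP|a u uP].
    by rewrite -[u]scale1r PL.
  by rewrite -[_ *: _]addr0 PL.
have sub_span (U : {vspace vT}) : (forall v, v \in U -> v \in P) ->
    (exists2 v, v \in P & v \notin U) ->
    exists2 W : {vspace vT}, (forall v, v \in W -> v \in P) & (\dim U < \dim W)%N.
  move=> UP [v vP vU]; exists (U + <[v]>)%VS => [w /memv_addP[u /UP uP]|].
    by case=> _ /vlineP[a ->] ->; rewrite PD // PZ.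
  rewrite ltn_neqAle dimvS ?addvSl // andbT; apply: contra vU => /eqP dU.
  have /eqP -> : U == (U + <[v]>)%VS by rewrite eqEdim addvSl dU leqnn.
  by apply: (subvP (addvSr U _)); exact: memv_line.
have [m] := ubnP (\dim (fullv : {vspace vT}) - \dim (0%VS : {vspace vT}))%N.
have : forall v : vT, v \in (0%VS : {vspace vT}) -> v \in P.
  by move=> v /[!memv0] /eqP ->; rewrite P0.
elim: m (0%VS : {vspace vT}) => // m IH U UP lt_m.
case: (pselect (exists2 v, v \in P & v \notin U)) => [ex|nex].
  have [W WP ltUW] := sub_span U UP ex.
  have leW : (\dim W <= \dim (fullv : {vspace vT}))%N by rewrite dimvS ?subvf.
  apply: (IH W WP); rewrite -ltnS; apply: leq_trans lt_m.
  by rewrite !ltnS ltn_sub2l // (leq_trans ltUW).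
exists U => v; apply/idP/idP => [/UP //|vP].
by apply: contra_notT nex => vU; exists v.
Qed.

(* A subset of P^n is represented by the set of all homogeneous coordinate
   vectors of its points: a set of nonzero vectors of K^(n+1). *)
Section Projective.
Variables (K : fieldType) (n : nat).
Implicit Types (V A B Z : set ('I_n.+1 -> K)) (p : {mpoly K[n.+1]}).

Definition zero_locus (S : set {mpoly K[n.+1]}) : set ('I_n.+1 -> K) :=
  [set x | (exists i, x i != 0) /\ forall p, S p -> p.@[x] = 0].

Definition proj_closed Z : Prop :=
  exists S : set {mpoly K[n.+1]},
    (forall p, S p -> exists e, p \is e.-homog) /\ Z = zero_locus S.

Definition proj_irreducible Z : Prop :=
  Z !=set0 /\
  forall A B, proj_closed A -> proj_closed B ->
    Z `<=` A `|` B -> Z `<=` A \/ Z `<=` B.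

Definition proj_subvariety V : Prop := proj_closed V /\ proj_irreducible V.

Definition subvariety_chain V (m : nat) : Prop :=
  exists Z : nat -> set ('I_n.+1 -> K),
    (forall i, (i <= m)%N -> proj_subvariety (Z i) /\ Z i `<=` V) /\
    (forall i, (i < m)%N -> Z i `<` Z i.+1).

Definition proj_dim_eq V (k : nat) : Prop :=
  subvariety_chain V k /\ forall m, subvariety_chain V m -> (m <= k)%N.

(* As V is stable under nonzero scalars, over an infinite field this is the
   homogeneous ideal generated by the forms vanishing on V. *)
Definition vanishing_ideal V : set {mpoly K[n.+1]} :=
  [set p | forall x, V x -> p.@[x] = 0].

Section DegreePart.
Variables (V : set ('I_n.+1 -> K)) (d : nat).

Fact vanishing_forms_ex : exists U : {vspace dhomog n.+1 K d},
  forall p : dhomog n.+1 K d, (p \in U) = `[< vanishing_ideal V (val p) >].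
Proof.
apply: (@submod_vspace _ _
  [pred p : dhomog n.+1 K d | `[< vanishing_ideal V (val p) >]]).
split=> [|a p q]; first by apply/asboolP => x _; rewrite /= raddf0.
move=> /asboolP pV /asboolP qV; apply/asboolP => x Vx.
by rewrite /= mevalD mevalZ pV // qV // mulr0 addr0.
Qed.

(* The intersection of the vanishing ideal with the space of forms of
   degree d, characterized by [mem_vanishing_forms]. *)
Definition vanishing_forms : {vspace dhomog n.+1 K d} :=
  sval (cid vanishing_forms_ex).

Lemma mem_vanishing_forms (p : dhomog n.+1 K d) :
  (p \in vanishing_forms) = `[< vanishing_ideal V (val p) >].
Proof. exact: (svalP (cid vanishing_forms_ex)). Qed.

Definition quot_forms : vectType K := vquot vanishing_forms.

Definition form_class (p : dhomog n.+1 K d) : quot_forms :=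
  vquot_class vanishing_forms p.

Definition rank_forms (q : nat) (Q : 'I_q -> dhomog n.+1 K d)
    (S : {set 'I_q}) : nat :=
  \dim <<[seq form_class (Q i) | i <- enum S]>>%VS.

End DegreePart.

Definition hypersurface (d : nat) (p : dhomog n.+1 K d) : set ('I_n.+1 -> K) :=
  zero_locus [set val p].

Definition subgeneral_position (N k : nat) V (d q : nat)
    (Q : 'I_q -> dhomog n.+1 K d) : Prop :=
  (k + 1 <= q)%N /\
  forall S : {set 'I_q}, #|S| = (N + 1)%N ->
    V `&` \bigcap_(i in [set` S]) hypersurface (Q i) = set0.

End Projective.

(* Main.v *)
Require Import Defs.
From HB Require Import structures.
From mathcomp Require Import all_boot all_order all_algebra.
From mathcomp Require Import complex.
From mathcomp Require Import boolp classical_sets reals exp.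
From mathcomp Require Import mpoly.
From mathcomp Require Import zify ring lra.

(** The rank of a set of forms, cut off at k + 1, is the rank function of a
    matroid on the indices, and everything follows from two facts about it.

    The geometric fact is that N + 1 of the hypersurfaces have rank at least
    k + 1 ([full_rank_of_empty_intersection]): otherwise their common zeros on
    V would already be cut out by k forms, and k forms of positive degree have
    a common zero on a variety that carries a chain of k + 1 irreducible
    subvarieties ([chain_common_zero]).  The latter is proved by comparing
    growths of Hilbert functions.  Going up one step in the chain
    multiplies the growth of the Hilbert function by a linear factor, since a
    form that vanishes on the smaller variety but not on the larger one is a
    nonzerodivisor ([chain_growth]).  Adding one form to an ideal divides the
    growth by at most a linear factor ([growth_le_adjoin_seq]).  Hence k forms
    cannot bring the Hilbert function of the top of the chain down to 0, and a
    homogeneous ideal whose Hilbert function never vanishes has a zero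
    ([projective_Nullstellensatz]).

    The combinatorial fact is the existence of the weights
    ([nochka_weights]).  Write rho for the truncated rank and
    m = 2N - k + 1.  The largest weight c is the largest slope from a point
    (|A|, rho A), |A| <= N, to the point (m, k + 1); at a set T0 that attains
    it, the weights sum to rho T0, and all other indices get weight c, which
    forces the required total.  The bound w(A) <= rho A for
    |A| <= N + 1 comes from submodularity, and contains iv).

    Finally v) is the optimality of the greedy algorithm
    ([greedy_basis]): after taking logarithms, a weight that is dominated by
    the rank is, against a nonnegative function, at most the value of the
    basis chosen greedily. *)

Set Implicit Arguments.
Unset Strict Implicit.
Unset Printing Implicit Defensive.

Import Order.TTheory GRing.Theory Num.Theory.
Local Open Scope classical_set_scope.
Local Open Scope ring_scope.

(** * Hilbert functions of homogeneous ideals *)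

Lemma codim_add_limg (K : fieldType) (aT rT : vectType K) (L : 'Hom(aT, rT))
    (J : {vspace rT}) :
  (\dim {:rT} - \dim J
    = \dim {:rT} - \dim (J + limg L) + (\dim {:aT} - \dim (L @^-1: J)))%N.
Proof.
have EA := dimv_sum_cap J (limg L).
have imL : (L @: (L @^-1: J) = J :&: limg L)%VS.
  by rewrite -lpreim_cap_limg lpreimK ?capvSr.
have kerL : (lker L <= L @^-1: J)%VS.
  by rewrite -(lpreim0 L); apply/lpreimS/sub0v.
have := limg_ker_dim L (L @^-1: J); rewrite imL (capv_idPr kerL) => E1.
have := limg_ker_dim L fullv; rewrite capfv => E2.
have : (\dim (J + limg L) <= \dim {:rT})%N by rewrite dimvS ?subvf.
have : (\dim (L @^-1: J) <= \dim {:aT})%N by rewrite dimvS ?subvf.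
lia.
Qed.

Section GradedIdeals.
Variables (K : fieldType) (n : nat).

Local Notation form := (dhomog n.+1 K).

(** Projecting every polynomial to its part of degree [e] lets membership in a
    degree part be tested on polynomials, where degrees can be rewritten. *)
Definition form_part e (p : {mpoly K[n.+1]}) : form e :=
  DHomog (pihomogP mdeg e p).

Fact form_part_is_linear e : linear (form_part e).
Proof. by move=> a p q; apply/val_inj; exact: (linearP (pihomog mdeg e)). Qed.
HB.instance Definition _ e :=
  GRing.isLinear.Build K {mpoly K[n.+1]} (form e) _ (form_part e)
    (form_part_is_linear e).

Lemma form_partK e (p : {mpoly K[n.+1]}) :
  p \is e.-homog -> val (form_part e p) = p.
Proof. exact: pihomog_dE. Qed.

Lemma form_part_val e (p : form e) : form_part e (val p) = p.
Proof. by apply/val_inj; exact: (pihomog_dE (valP p)). Qed.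

Definition mul_form (f : {mpoly K[n.+1]}) (c e : nat) (v : form c) : form e :=
  form_part e (f * val v).

Fact mul_form_is_linear f c e : linear (@mul_form f c e).
Proof.
by move=> a p q; rewrite /mul_form !linearP /= mulrDr -scalerAr linearP.
Qed.
HB.instance Definition _ f c e :=
  GRing.isLinear.Build K (form c) (form e) *:%R (@mul_form f c e)
    (@mul_form_is_linear f c e).

Definition family := forall e, {vspace (dhomog n.+1 K e)}.

Implicit Types (I : family) (f g : {mpoly K[n.+1]}).

Definition graded_ideal (I : family) : Prop :=
  forall c e (f : {mpoly K[n.+1]}) (p : {mpoly K[n.+1]}),
    f \is c.-homog -> p \is e.-homog -> form_part e p \in I e ->
    form_part (c + e) (f * p) \in I (c + e)%N.

(** When [e < d] the truncated [e - d] is 0 and [form_part] discards the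
    product, which has degree [d], so that nothing is added. *)
Definition adjoin (I : family) (f : {mpoly K[n.+1]}) (d : nat) : family :=
  fun e => (I e + limg (linfun (@mul_form f (e - d) e)))%VS.

Definition hilb (I : family) e : nat := (\dim {:form e} - \dim (I e))%N.

Lemma mem_adjoin I f d e (p : form e) :
  reflect (exists2 u, u \in I e &
     exists2 v : {mpoly K[n.+1]}, v \is (e - d).-homog &
       p = u + form_part e (f * v))
   (p \in adjoin I f d e).
Proof.
apply: (iffP memv_addP) => [[u uI [w /memv_imgP[v _ ->] ->]]|[u uI [v vh ->]]].
  by exists u => //; exists (val v); [exact: (valP v) | rewrite lfunE].
exists u => //; exists (form_part e (f * v)) => //.
apply/memv_imgP; exists (form_part (e - d) v); first exact: memvf.
by rewrite lfunE /= /mul_form form_partK.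
Qed.

Lemma sub_adjoin I f d e : (I e <= adjoin I f d e)%VS.
Proof. exact: addvSl. Qed.

Lemma adjoin_ideal I f d :
  f \is d.-homog -> graded_ideal I -> graded_ideal (adjoin I f d).
Proof.
move=> fh Iid a e g p gh ph /mem_adjoin[u uI [v vh pE]].
have uh := valP u.
have [led|ltd] := leqP d e.
  apply/mem_adjoin; exists (form_part (a + e) (g * val u)).
    by apply: Iid => //; rewrite form_part_val.
  exists (g * v); first by rewrite -addnBA //; exact: dhomogM.
  rewrite mulrCA -linearD -mulrDr /=; congr (form_part _ (g * _)).
  have /(congr1 val) := pE; rewrite form_partK // => -> /=.
  by rewrite pihomog_dE // -(subnKC led); exact: dhomogM.
have e0 : (e - d = 0)%N by apply/eqP; rewrite subn_eq0 ltnW.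
have : form_part e (f * v) = 0.
  apply/val_inj; rewrite /=; apply: (@pihomog_ne0 _ _ _ d).
    by rewrite gtn_eqF.
  by have := dhomogM fh vh; rewrite e0 addn0.
move: pE => /[swap] -> /[!addr0] pE.
by apply: (subvP (sub_adjoin _ _ _ _)); apply: Iid; rewrite // pE.
Qed.

Lemma adjoin_gen I f d : f \is d.-homog ->
  form_part d f \in adjoin I f d d.
Proof.
move=> fh; apply/mem_adjoin; exists 0; first exact: mem0v.
by exists 1; rewrite ?subnn ?dhomog1 // mulr1 add0r.
Qed.

Definition colon (I : family) (f : {mpoly K[n.+1]}) (d e : nat) :
    {vspace (form e)} :=
  (linfun (@mul_form f e (e + d)) @^-1: I (e + d)%N)%VS.

Lemma mem_colon I f d e (p : form e) :
  (p \in colon I f d e) = (form_part (e + d) (f * val p) \in I (e + d)%N).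
Proof. by rewrite -memv_preim lfunE. Qed.

Lemma sub_colon I f d e :
  f \is d.-homog -> graded_ideal I -> (I e <= colon I f d e)%VS.
Proof.
move=> fh Iid; apply/subvP => p pI; rewrite mem_colon addnC.
by apply: Iid => //; [exact: (valP p) | rewrite form_part_val].
Qed.

(** Multiplication by [f] identifies the quotient of the forms of degree [e] by
    the colon ideal with what [f] adds in degree [e + d]. *)
Lemma hilb_adjoin I f d e :
  hilb I (e + d)%N
    = (hilb (adjoin I f d) (e + d) + (\dim {:form e} - \dim (colon I f d e)))%N.
Proof. by rewrite /hilb /adjoin addnK; exact: codim_add_limg. Qed.

Lemma hilb_adjoin_le I f d e : f \is d.-homog -> graded_ideal I ->
  (hilb I (e + d) <= hilb I e + hilb (adjoin I f d) (e + d))%N.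
Proof.
move=> fh Iid; rewrite (hilb_adjoin I f d e) addnC leq_add2r leq_sub2l //.
exact/dimvS/sub_colon.
Qed.

Lemma hilb_adjoin_regular I f d e :
  (forall p : form e,
     form_part (e + d) (f * val p) \in I (e + d)%N -> p \in I e) ->
  (hilb I e + hilb (adjoin I f d) (e + d) <= hilb I (e + d))%N.
Proof.
move=> reg; rewrite [leqRHS](hilb_adjoin I f d e) addnC leq_add2l leq_sub2l //.
by apply/dimvS/subvP => p; rewrite mem_colon => /reg.
Qed.

(** If [f] generates everything modulo [I] in degree [e + d], multiplication by
    [f] is onto the quotient there; the quotients having the same dimension, it
    is also injective. *)
Lemma regular_of_hilb_eq I f d e (p : form e) :
  f \is d.-homog -> graded_ideal I ->
  hilb I (e + d)%N = hilb I e -> hilb (adjoin I f d) (e + d) = 0%N ->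
  form_part (e + d) (f * val p) \in I (e + d)%N -> p \in I e.
Proof.
move=> fh Iid H1 H2; rewrite -mem_colon; move: H1.
rewrite (hilb_adjoin I f d e) H2 add0n.
rewrite /hilb => H.
have sub : (I e <= colon I f d e)%VS by apply: sub_colon.
suff /eqP -> : I e == colon I f d e by [].
rewrite eqEdim sub /=.
have A1 : (\dim (I e) <= \dim {:form e})%N by rewrite dimvS ?subvf.
have A2 : (\dim (colon I f d e) <= \dim {:form e})%N by rewrite dimvS ?subvf.
lia.
Qed.

Lemma hilb_eq0 (I : family) e : (hilb I e == 0%N) = (I e == fullv).
Proof. by rewrite subn_eq0 eqEdim subvf. Qed.

Lemma hilbS (I J : family) e : (I e <= J e)%VS -> (hilb J e <= hilb I e)%N.
Proof. by move=> IJ; rewrite leq_sub2l // dimvS. Qed.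

End GradedIdeals.

(** * Polynomial growth of cumulative sums *)

(** Growth is measured on cumulative sums: then a function that is eventually 0
    has growth exponent 0, and both recursions below raise the exponent uniformly by
    one, without a special case at the bottom. *)
Definition csum (h : nat -> nat) e : nat := (\sum_(i < e.+1) h i)%N.

Definition growth_le r h := exists C, forall e, (csum h e <= C * e.+1 ^ r)%N.
Definition growth_ge r h := exists C, forall e, (e.+1 ^ r <= C * csum h e)%N.

Lemma csum_split h e d :
  csum h (e + d) = (\sum_(i < d) h i + \sum_(i < e.+1) h (i + d)%N)%N.
Proof.
rewrite /csum -addSn addnC big_split_ord /=; congr addn.
by apply: eq_bigr => i _; rewrite addnC.
Qed.

Lemma csum_homo h e e' : (e <= e')%N -> (csum h e <= csum h e')%N.
Proof.
by move=> ee'; rewrite -(subnKC ee') /csum -addSn big_split_ord leq_addr.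
Qed.

Lemma growth_le_eventually0 h e0 :
  (forall e, (e0 <= e)%N -> h e = 0%N) -> growth_le 0 h.
Proof.
move=> h0; exists (csum h e0) => e; rewrite expn0 muln1.
have [le_e|lt_e] := leqP e0 e; last first.
  exact/csum_homo/ltnW.
have -> : csum h e = csum h (e0 + (e - e0)) by rewrite subnKC.
rewrite /csum -addSn big_split_ord /= [X in (_ + X)%N]big1 ?addn0 // => i _.
by apply: h0; lia.
Qed.

Lemma growth_le_step d g h r : (0 < d)%N ->
  (forall e, h (e + d)%N <= h e + g (e + d)%N)%N ->
  growth_le r g -> growth_le r.+1 h.
Proof.
move=> d0 step [C Cg].
pose B := csum h d.
have sumstep e : (csum h (e + d) <= csum h e + (B + csum g (e + d)))%N.
  rewrite csum_split [leqRHS]addnCA leq_add //.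
    by rewrite /B /csum big_ord_recr leq_addr.
  rewrite csum_split [leqRHS]addnCA; apply: leq_trans (leq_addl _ _).
  by rewrite /csum -big_split leq_sum.
(* B absorbs the values below d, where the recursion does not apply *)
exists (B + C)%N => e; have [m] := ubnP e; elim: m e => // m IH e.
rewrite ltnS => em; have [ed|de] := ltnP e d.
  apply: (@leq_trans B).
    exact/csum_homo/ltnW.
  by rewrite -[leqLHS]muln1 leq_mul ?leq_addr // expn_gt0.
rewrite -[X in csum h X](subnK de); apply: leq_trans (sumstep _) _.
rewrite subnK //.
have IHe : (csum h (e - d) <= (B + C) * (e - d).+1 ^ r.+1)%N by apply: IH; lia.
have gb : (B + csum g e <= (B + C) * e.+1 ^ r)%N.
  by rewrite mulnDl leq_add // -[leqLHS]muln1 leq_mul // expn_gt0.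
apply: leq_trans (leq_add IHe gb) _.
rewrite -mulnDr leq_mul // !expnS.
apply: (@leq_trans ((e - d).+1 * e.+1 ^ r + e.+1 ^ r)).
  by rewrite leq_add2r leq_mul //; case: (r) => // r';
    rewrite leq_exp2r // ltnS leq_subr.
by rewrite -{2}[(e.+1 ^ r)%N]mul1n -mulnDl leq_mul //; lia.
Qed.

Lemma growth_ge_pos h : (forall e, 0 < h e)%N -> growth_ge 1 h.
Proof.
move=> h0; exists 1%N => e; rewrite mul1n expn1.
rewrite -[leqLHS]muln1 -[X in (X * _)%N]card_ord -sum_nat_const.
exact: leq_sum.
Qed.

Lemma expn_addl_le x d r :
  ((x + d) ^ r.+1 <= x ^ r.+1 + d * r.+1 * (x + d) ^ r)%N.
Proof.
elim: r => [|r IH]; first by rewrite !expn1 expn0 !muln1.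
rewrite expnS mulnDl [in X in (_ <= X)%N]expnS.
apply: leq_trans (leq_add (leq_mul (leqnn x) IH) (leqnn _)) _.
rewrite mulnDr -addnA leq_add2l.
have : (x * (x + d) ^ r <= (x + d) ^ r.+1)%N.
  by rewrite expnS leq_mul // leq_addr.
move: ((x + d) ^ r)%N ((x + d) ^ r.+1)%N => u v uv.
have -> : (x * (d * r.+1 * u) = d * r.+1 * (x * u))%N by ring.
apply: leq_trans (leq_add (leq_mul (leqnn _) uv) (leqnn _)) _.
lia.
Qed.

Lemma growth_ge_step d g h r : (0 < d)%N ->
  (forall e, h e + g (e + d)%N <= h (e + d)%N)%N ->
  (forall e, g e <= h e)%N ->
  growth_ge r g -> growth_ge r.+1 h.
Proof.
move=> d0 step gh [C Cg].
have sumstep e : (csum h e + csum g (e + d) <= csum h (e + d))%N.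
  rewrite csum_split (csum_split h) addnCA leq_add ?leq_sum //.
  by rewrite /csum -big_split leq_sum.
(* d * r.+1 bounds the increment of (e.+1)^(r.+1) over d steps *)
exists (C * (d * r.+1))%N => e; have [m] := ubnP e; elim: m e => // m IH e.
rewrite ltnS => em.
have gd : (d * r.+1 * e.+1 ^ r <= C * (d * r.+1) * csum g e)%N.
  have -> : (C * (d * r.+1) * csum g e = d * r.+1 * (C * csum g e))%N by ring.
  by rewrite leq_mul.
have [ed|de] := ltnP e d.
  apply: (@leq_trans (C * (d * r.+1) * csum g e)); last first.
    by rewrite leq_mul // leq_sum.
  by apply: leq_trans gd; rewrite expnS leq_mul //; nia.
have := sumstep (e - d)%N; rewrite subnK // => H.
apply: leq_trans (leq_mul (leqnn (C * (d * r.+1))%N) H).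
rewrite mulnDr.
apply: leq_trans (leq_add (IH (e - d)%N _) gd); last by lia.
have := expn_addl_le (e - d).+1 d r.
by rewrite addSn subnK.
Qed.

Lemma growth_le_ge r s h : growth_le r h -> growth_ge s h -> (s <= r)%N.
Proof.
move=> [C Ch] [D Dh]; rewrite leqNgt; apply/negP => rs.
have := leq_trans (Dh (D * C)%N) (leq_mul (leqnn D) (Ch _)).
rewrite -(subnKC rs) addSn expnS expnD mulnA.
set y := (D * C)%N; set z := (y.+1 ^ r)%N; set t := (_ ^ (s - _))%N.
have : (0 < z)%N by rewrite expn_gt0.
have : (0 < t)%N by rewrite expn_gt0.
rewrite mulnA -/y; nia.
Qed.

(** * The projective Nullstellensatz *)

Lemma linear_preim_nontrivial (K : fieldType) (aT rT : vectType K)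
    (L : aT -> rT) (U : {vspace rT}) : linear L ->
  (\dim {:rT} - \dim U < \dim {:aT})%N -> exists2 v, v != 0 & L v \in U.
Proof.
move=> linL; pose L' : {linear aT -> rT} :=
  HB.pack L (GRing.isLinear.Build K aT rT *:%R L linL).
rewrite (codim_add_limg (linfun L') U) => lt_dim.
have : (linfun L' @^-1: U)%VS != 0%VS by rewrite -dimv_eq0; lia.
set W := (_ @^-1: _)%VS; exists (vpick W); rewrite ?vpick0 //.
by have := memv_pick W; rewrite -memv_preim lfunE.
Qed.

Lemma nonincreasing_stable (h : nat -> nat) e0 :
  (forall e, (e0 <= e)%N -> (h e.+1 <= h e)%N) ->
  exists2 e1, (e0 <= e1)%N & forall e, (e1 <= e)%N -> h e = h e1.
Proof.
have [m] := ubnP (h e0); elim: m e0 => // m IH e0 hm mono.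
have [[e [e0e he]]|nex] := pselect (exists e, (e0 <= e)%N /\ (h e < h e0)%N).
  have [||e1 ee1 st] := IH e; first by lia.
    by move=> e' ee'; apply: mono; lia.
  by exists e1 => //; lia.
exists e0 => // e; elim: e => [|e IHe]; first by rewrite leqn0 => /eqP ->.
rewrite leq_eqVlt => /orP[/eqP -> //|]; rewrite ltnS => e0e.
apply/eqP; rewrite eqn_leq -{1}(IHe e0e) mono //= leqNgt; apply/negP => lt.
by apply: nex; exists e.+1; split=> //; lia.
Qed.

Section IdealMembership.
Variables (K : fieldType) (n : nat).
Implicit Types (I : family K n) (f p : {mpoly K[n.+1]}).

Definition in_degree I e p : bool := form_part e p \in I e.

Lemma in_degreeD I e p f :
  in_degree I e p -> in_degree I e f -> in_degree I e (p + f).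
Proof. by rewrite /in_degree linearD; exact: memvD. Qed.

Lemma in_degreeB I e p f :
  in_degree I e p -> in_degree I e f -> in_degree I e (p - f).
Proof. by rewrite /in_degree linearB; exact: memvB. Qed.

Lemma in_degreeZ I e (c : K) p : in_degree I e p -> in_degree I e (c *: p).
Proof. by rewrite /in_degree linearZ; exact: memvZ. Qed.

Lemma in_degree_sum I e (T : Type) (s : seq T) (P : pred T) F :
  (forall i, P i -> in_degree I e (F i)) ->
  in_degree I e (\sum_(i <- s | P i) F i).
Proof. by rewrite /in_degree linear_sum => IF; exact: memv_suml. Qed.

Lemma in_degreeM I d e f p : graded_ideal I ->
  f \is d.-homog -> p \is e.-homog -> in_degree I e p ->
  in_degree I (d + e) (f * p).
Proof. by move=> Iid; exact: Iid. Qed.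

Lemma homog_var i : ('X_i : {mpoly K[n.+1]}) \is 1.-homog.
Proof. by rewrite dhomogX /= mdeg1. Qed.

Lemma homog_exp e f : f \is 1.-homog -> f ^+ e \is e.-homog.
Proof. by move=> /(dhomogMn e); rewrite mul1n. Qed.

Lemma homog_mnm_split (m : 'X_{1..n.+1}) e : mdeg m = e.+1 ->
  exists i, exists2 m', mdeg m' = e & m = (U_(i) + m')%MM.
Proof.
move=> dm; have [i mi|m0] := pickP (fun i => m i != 0%N); last first.
  by move: dm; rewrite mdegE big1 // => i _; have /negbFE/eqP := m0 i.
have mE : m = (U_(i) + (m - U_(i)))%MM.
  by rewrite addmC submK // lep1mP.
exists i, (m - U_(i))%MM => //.
by move: dm; rewrite {1}mE mdegD mdeg1 => -[].
Qed.

Lemma full_of_monomials I e :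
  (forall m, mdeg m = e -> in_degree I e 'X_[m]) -> I e = fullv.
Proof.
move=> IX; apply/eqP; rewrite eqEsubv subvf /=; apply/subvP => p _.
rewrite -(form_part_val p) -/(in_degree I e (val p)) [val p]mpolyE.
rewrite big_seq; apply: in_degree_sum => m mp; apply/in_degreeZ/IX.
exact: (dhomog_mf (valP p)).
Qed.

Lemma hilb_eq0_leq I e e' : graded_ideal I ->
  hilb I e = 0%N -> (e <= e')%N -> hilb I e' = 0%N.
Proof.
move=> Iid /eqP; rewrite hilb_eq0 => /eqP Ie /subnKC <-.
apply/eqP; rewrite hilb_eq0; apply/eqP.
elim: (e' - e)%N => [|t IH]; first by rewrite addn0.
rewrite addnS; apply: full_of_monomials => m /homog_mnm_split[i [m' dm' ->]].
rewrite mpolyXD -add1n; apply: in_degreeM => //; rewrite ?dhomogX /= ?mdeg1 ?dm' //.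
by rewrite /in_degree IH memvf.
Qed.

(** The binary form of degree [c] obtained from [p] by substituting
    [y / x] for the variable and multiplying by [x ^+ c]. *)
Definition homogenize (x y : {mpoly K[n.+1]}) (c : nat) (p : {poly K}) :=
  \sum_(t < c.+1) p`_t *: (x ^+ (c - t) * y ^+ t).

Fact homogenize_is_linear x y c : linear (homogenize x y c).
Proof.
move=> a p q; rewrite /homogenize scaler_sumr -big_split /=.
by apply: eq_bigr => t _; rewrite coefD coefZ scalerDl scalerA.
Qed.
HB.instance Definition _ x y c :=
  GRing.isLinear.Build K {poly K} {mpoly K[n.+1]} *:%R (homogenize x y c)
    (@homogenize_is_linear x y c).

Lemma homogenize_homog x y c (p : {poly K}) :
  x \is 1.-homog -> y \is 1.-homog -> homogenize x y c p \is c.-homog.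
Proof.
move=> xh yh; apply: rpred_sum => t _; apply: dhomogZ.
have := dhomogM (homog_exp (c - t) xh) (homog_exp t yh).
by rewrite subnK // -ltnS.
Qed.

Lemma homogenizeS x y c (p : {poly K}) :
  (size p <= c.+1)%N -> homogenize x y c.+1 p = x * homogenize x y c p.
Proof.
move=> sp; rewrite /homogenize big_ord_recr /= (nth_default _ sp) scale0r addr0.
rewrite mulr_sumr; apply: eq_bigr => t _.
by rewrite -scalerAr mulrA -exprS subSn // -ltnS.
Qed.

Lemma homogenizeX x y c (p : {poly K}) :
  homogenize x y c.+1 ('X * p) = y * homogenize x y c p.
Proof.
rewrite /homogenize big_ord_recl /= coefXM eqxx scale0r add0r.
rewrite mulr_sumr; apply: eq_bigr => t _.
by rewrite coefXM /= subSS -scalerAr mulrCA -exprS.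
Qed.

Lemma homogenize_factor x y c r (p : {poly K}) : (size p <= c.+1)%N ->
  homogenize x y c.+1 (p * ('X - r%:P)) = (y - r *: x) * homogenize x y c p.
Proof.
move=> sp; rewrite mulrC mulrBl linearB /= homogenizeX mul_polyC linearZ /=.
by rewrite homogenizeS // mulrBl scalerAl.
Qed.

End IdealMembership.

Section Nullstellensatz.
Variables (K : closedFieldType) (n : nat).
Implicit Types (I : family K n) (f p : {mpoly K[n.+1]}).

(** A binary form that sends [v] into [I] splits into linear factors; multiply
    [v] by them one at a time and stop just before the product enters [I]. *)
Lemma linear_factor_kills I x y e v : graded_ideal I ->
  x \is 1.-homog -> y \is 1.-homog -> v \is e.-homog -> ~~ in_degree I e v ->
  forall c (p : {poly K}), p != 0 -> (size p <= c.+1)%N ->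
    in_degree I (c + e) (homogenize x y c p * v) ->
  exists e' u, [/\ (e <= e')%N, u \is e'.-homog, ~~ in_degree I e' u &
    in_degree I e'.+1 (x * u) \/ exists r, in_degree I e'.+1 ((y - r *: x) * u)].
Proof.
move=> Iid xh yh vh vI; elim=> [|c IH] p p0 sp.
  have [a a0 ->] : exists2 a, a != 0 & p = a%:P.
    have pE := size1_polyC sp; exists p`_0 => //.
    by rewrite -polyC_eq0 -pE.
  rewrite /homogenize big_ord1 coefC /= mulr1 -scalerAl mul1r.
  move=> /(in_degreeZ a^-1); rewrite scalerA mulVf // scale1r.
  by rewrite add0n (negPf vI).
have step (q : {poly K}) : q != 0 -> (size q <= c.+1)%N -> forall l,
    (l = x \/ exists r, l = y - r *: x) ->
    in_degree I (c.+1 + e) (l * homogenize x y c q * v) ->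
  exists e' u, [/\ (e <= e')%N, u \is e'.-homog, ~~ in_degree I e' u &
    in_degree I e'.+1 (x * u) \/ exists r, in_degree I e'.+1 ((y - r *: x) * u)].
  move=> q0 sq l lE inI.
  have [qI|qI] := boolP (in_degree I (c + e) (homogenize x y c q * v)).
    exact: IH qI.
  exists (c + e)%N, (homogenize x y c q * v); split=> //; first exact: leq_addl.
    by apply: dhomogM => //; exact: homogenize_homog.
  by case: lE inI => [->|[r ->]]; rewrite -mulrA addSn => inI;
    [left|right; exists r].
have [sp'|sp'] := leqP (size p) c.+1.
  by rewrite homogenizeS //; apply: step => //; left.
have [|r /factor_theorem[q pE]] := @closed_rootP _ p _.
  by rewrite neq_ltn (leq_trans _ sp') ?orbT.
have q0 : q != 0 by apply: contraNneq p0 => q0; rewrite pE q0 mul0r.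
have sq : (size q <= c.+1)%N 
  by move: sp; rewrite pE size_Mmonic ?monicXsubC // size_XsubC addn2.
by rewrite pE homogenize_factor //; apply: step => //; right; exists r.
Qed.


Lemma exists_form_notin I e : (0 < hilb I e)%N ->
  exists2 v : {mpoly K[n.+1]}, v \is e.-homog & ~~ in_degree I e v.
Proof.
move=> Ie; have [//|nex] := pselect (exists2 v : {mpoly K[n.+1]},
  v \is e.-homog & ~~ in_degree I e v).
move: Ie; rewrite lt0n hilb_eq0 => /negP[]; apply/eqP/full_of_monomials => m dm.
apply: contra_notT nex => mI; exists 'X_[m] => //.
by rewrite dhomogX /= dm.
Qed.

Lemma eventually_regular I (l : {mpoly K[n.+1]}) e1 : graded_ideal I ->
  l \is 1.-homog -> (forall e, (e1 <= e)%N -> hilb I e = hilb I e1) ->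
  (exists e, hilb (adjoin I l 1) e = 0%N) ->
  exists2 e0, (e1 <= e0)%N & forall e p, (e0 <= e)%N -> p \is e.-homog ->
    in_degree I e.+1 (l * p) -> in_degree I e p.
Proof.
move=> Iid lh hst [e2 he2]; exists (maxn e1 e2); first exact: leq_maxl.
move=> e p; rewrite geq_max => /andP[e1e e2e] ph lpI.
apply: (@regular_of_hilb_eq _ _ I l 1 e (form_part e p)) => //.
- by rewrite addn1 !hst // ltnW.
- by apply: hilb_eq0_leq he2 _; [exact: adjoin_ideal | lia].
- by rewrite form_partK // addn1.
Qed.

(** If adjoining any new linear form to [I] leaves nothing in large degrees,
    then [I] behaves like the ideal of a single point: all linear forms are
    proportional modulo [I].  Indeed the Hilbert function is eventually
    constant, so that every linear form outside [I] is regular in large degrees,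
    whereas an eigenvalue [r] of [y / x] makes [y - r x] fail to be regular; so
    [y - r x] lies in [I]. *)
Lemma linear_form_congr I (x : {mpoly K[n.+1]}) : graded_ideal I ->
  (forall e, (0 < hilb I e)%N) -> x \is 1.-homog -> ~~ in_degree I 1 x ->
  (forall l, l \is 1.-homog -> ~~ in_degree I 1 l ->
     exists e, hilb (adjoin I l 1) e = 0%N) ->
  forall y, y \is 1.-homog -> exists r, in_degree I 1 (y - r *: x).
Proof.
move=> Iid Ipos xh xI Imax y yh.
have [e0 he0] := Imax x xh xI.
have [e1 e01 hst] : exists2 e1, (e0 <= e1)%N &
    forall e, (e1 <= e)%N -> hilb I e = hilb I e1.
  apply: nonincreasing_stable => e e0e; have := hilb_adjoin_le e xh Iid.
  rewrite addn1 (@hilb_eq0_leq _ _ (adjoin I x 1) e0 e.+1) ?addn0 //.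
    exact: adjoin_ideal.
  by lia.
have [ex ex1 xreg] := eventually_regular Iid xh hst (Imax x xh xI).
have xregM t e p : (ex <= e)%N -> p \is e.-homog -> ~~ in_degree I e p ->
    ~~ in_degree I (t + e) (x ^+ t * p).
  move=> exe ph pI; elim: t => [|t IH]; first by rewrite mul1r.
  apply: contra IH; rewrite exprS -mulrA addSn; apply: xreg; first by lia.
  by apply: dhomogM => //; exact: homog_exp.
have [v vh vI] := exists_form_notin (Ipos ex).
(* the c.+1 products x^(c-t) y^t v are dependent modulo I, whose codimension
   in their degree is c *)
pose c := hilb I ex.
have [||r r0 rI] := @linear_preim_nontrivial _ _ _
    (fun r : 'rV[K]_c.+1 =>
       form_part (c + ex) (homogenize x y c (rVpoly r) * v))
    (I (c + ex)%N).
- by move=> a r s; rewrite !linearP mulrDl -scalerAl linearP.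
- have -> : \dim {:'rV[K]_c.+1} = c.+1 by rewrite dimvf dim_matrix Monoid.mul1m.
  rewrite ltnS -/(hilb I (c + ex)).
  by rewrite hst ?(leq_trans ex1) ?leq_addl // -(hst ex).
have [||e [u [exe uh uI [xuI|[s suI]]]]] :=
    linear_factor_kills Iid xh yh vh vI _ _ rI.
- by apply: contra_neq r0 => r0; rewrite -[r]rVpolyK r0 linear0.
- exact: size_poly.
- by rewrite (xreg e u) in uI.
exists s; apply: contraT => lI.
have lh : y - s *: x \is 1.-homog by apply: rpredB => //; exact: dhomogZ.
(* y - s x kills u; multiplying u by powers of x, which stay outside I,
   carries this to the degrees where y - s x is regular *)
have [es es1 lreg] := eventually_regular Iid lh hst (Imax _ lh lI).
have := xregM es e u exe uh uI; apply: contraNT => _.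
apply: lreg; first exact: leq_addr.
  by apply: dhomogM => //; exact: homog_exp.
rewrite mulrCA -addnS; apply: in_degreeM => //; first exact: homog_exp.
exact: (dhomogM lh uh).
Qed.

(** Adjoin linear forms as long as the ideal stays proper in every degree; this
    ends because the codimension in degree 1 drops.  Then all variables are
    multiples of a single one modulo [I], and the ratios are the coordinates of
    a zero. *)
Lemma projective_Nullstellensatz I : graded_ideal I ->
  (forall e, (0 < hilb I e)%N) ->
  exists2 a : 'I_n.+1 -> K, exists i, a i != 0 &
    forall e p, p \is e.-homog -> in_degree I e p -> p.@[a] = 0.
Proof.
have [m] := ubnP (hilb I 1); elim: m I => // m IH I ltm Iid Ipos.
have [[l [lh lI lpos]]|nex] := pselect (exists l, [/\ l \is 1.-homog,
    ~~ in_degree I 1 l & forall e, (0 < hilb (adjoin I l 1) e)%N]).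
  have [||a a0 aI] := IH (adjoin I l 1) _ _ lpos; last 1 first.
  - exists a => // e p ph pI; apply: (aI e) => //.
    exact: (subvP (sub_adjoin _ _ _ _)).
  - rewrite ltnS in ltm; apply: leq_trans ltm; apply: ltn_sub2l.
      by have := Ipos 1%N; rewrite subn_gt0.
    rewrite ltn_neqAle dimvS ?sub_adjoin // andbT; apply: contra lI => eqd.
    rewrite /in_degree.
    suff /eqP -> : I 1%N == adjoin I l 1 1 by exact: adjoin_gen.
    by rewrite eqEdim sub_adjoin (eqP eqd) /=.
  - exact: adjoin_ideal.
have Imax l : l \is 1.-homog -> ~~ in_degree I 1 l ->
     exists e, hilb (adjoin I l 1) e = 0%N.
  move=> lh lI; apply: contrapT => ne; apply: nex; exists l; split=> // e.
  by rewrite lt0n; apply/eqP => e0; apply: ne; exists e.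
have Xh (i : 'I_n.+1) := homog_var K i.
have [i0 i0I] : exists i, ~~ in_degree I 1 'X_i.
  apply: contrapT => ne; have := Ipos 1%N; rewrite lt0n hilb_eq0 => /negP; apply.
  apply/eqP/full_of_monomials => m' /eqP; rewrite mdeg_eq1 => /existsP[i /eqP ->].
  by apply: contra_notT ne => iI; exists i.
have pt i := linear_form_congr Iid Ipos (Xh i0) i0I Imax (Xh i).
pose a i := sval (cid (pt i)).
have aI i : in_degree I 1 ('X_i - a i *: 'X_i0) by rewrite /a; case: cid.
have Xe e : ('X_i0 ^+ e : {mpoly K[n.+1]}) \is e.-homog.
  exact: homog_exp.
(* reduction modulo I is evaluation at a, up to a power of 'X_i0 *)
have aX e : forall m', mdeg m' = e ->
    in_degree I e ('X_[m'] - ('X_[m']).@[a] *: 'X_i0 ^+ e).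
  elim: e => [|e IHe] m'.
    move/eqP; rewrite mdeg_eq0 => /eqP ->.
    by rewrite mpolyX0 meval1 scale1r subrr /in_degree linear0 mem0v.
  move=> /homog_mnm_split[i [m2 dm2 ->]].
  rewrite mpolyXD mevalM mevalXU.
  have -> : 'X_i * 'X_[m2] - (a i * ('X_[m2]).@[a]) *: 'X_i0 ^+ e.+1
    = 'X_i * ('X_[m2] - ('X_[m2]).@[a] *: 'X_i0 ^+ e)
      + ('X_[m2]).@[a] *: ('X_i0 ^+ e * ('X_i - a i *: 'X_i0)) :> {mpoly K[n.+1]}.
    rewrite -!mul_mpolyC !mpolyCM exprS; ring.
  apply: in_degreeD.
    rewrite -add1n; apply: in_degreeM => //; last exact: IHe.
    by apply: rpredB; [rewrite dhomogX /= dm2 | exact: dhomogZ].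
  apply: in_degreeZ; rewrite -addn1; apply: in_degreeM => //.
  by apply: rpredB => //; exact: dhomogZ.
exists a.
  exists i0; apply: contraNneq i0I => a0.
  by have := aI i0; rewrite a0 scale0r subr0.
move=> e p ph pI; apply: contraTeq (Ipos e) => pa0.
rewrite lt0n negbK hilb_eq0; apply/eqP/full_of_monomials => m' dm'.
have paI : in_degree I e (p.@[a] *: 'X_i0 ^+ e).
  have : in_degree I e (p - p.@[a] *: 'X_i0 ^+ e).
    rewrite [p in p - _]mpolyE [p in p.@[a]]mpolyE raddf_sum scaler_suml -sumrB.
    rewrite big_seq; apply: in_degree_sum => m2 m2p.
    rewrite /= mevalZ -scalerA -scalerBr; apply/in_degreeZ/aX.
    exact: (dhomog_mf ph).
  by move=> /(in_degreeB pI); rewrite opprB addrCA subrr addr0.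
have XI : in_degree I e ('X_i0 ^+ e).
  by have := in_degreeZ (p.@[a])^-1 paI; rewrite scalerA mulVf // scale1r.
rewrite -['X_[m']](subrK (('X_[m']).@[a] *: 'X_i0 ^+ e)).
by apply: in_degreeD; [exact: aX | exact: in_degreeZ].
Qed.

End Nullstellensatz.

(** * Common zeros on a variety of given dimension *)

Section Dimension.
Variables (K : fieldType) (n : nat).
Implicit Types (V Z : set ('I_n.+1 -> K)) (f p : {mpoly K[n.+1]}).

Lemma in_vanishing_forms V e p : p \is e.-homog ->
  in_degree (vanishing_forms V) e p = `[< vanishing_ideal V p >].
Proof. by move=> ph; rewrite /in_degree mem_vanishing_forms form_partK. Qed.

Lemma vanishing_forms_ideal V : graded_ideal (vanishing_forms V).
Proof.
move=> c e f p fh ph; rewrite -!/(in_degree _ _ _).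
rewrite !in_vanishing_forms //; last exact: dhomogM.
by move=> /asboolP pV; apply/asboolP => x Vx; rewrite mevalM pV // mulr0.
Qed.

Lemma vanishing_forms_hilb_le V Z e : Z `<=` V ->
  (hilb (vanishing_forms Z) e <= hilb (vanishing_forms V) e)%N.
Proof.
move=> ZV; apply: hilbS; apply/subvP => p; rewrite !mem_vanishing_forms.
by move=> /asboolP pV; apply/asboolP => x /ZV; exact: pV.
Qed.

Lemma hilb_vanishing_forms_gt0 V e : proj_closed V -> V !=set0 ->
  (0 < hilb (vanishing_forms V) e)%N.
Proof.
move=> [S [_ ->]] [x [[i xi] xS]]; rewrite lt0n hilb_eq0; apply/negP => /eqP full.
have Xh : ('X_i ^+ e : {mpoly K[n.+1]}) \is e.-homog.
  exact/homog_exp/homog_var.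
have : in_degree (vanishing_forms (zero_locus S)) e ('X_i ^+ e).
  by rewrite /in_degree full memvf.
rewrite in_vanishing_forms // => /asboolP/(_ x) xe.
have /eqP : ('X_i ^+ e : {mpoly K[n.+1]}).@[x] = 0.
  by apply: xe; split=> //; exists i.
by rewrite rmorphXn /= mevalXU expf_eq0 (negPf xi) andbF.
Qed.

Lemma proj_closed_locus f d : f \is d.-homog -> proj_closed (zero_locus [set f]).
Proof. by move=> fh; exists [set f]; split=> // p ->; exists d. Qed.

(** Irreducibility enters here: Z is covered by the zeros of [f] and of [p]. *)
Lemma irreducible_nonzerodivisor Z f p d e : proj_subvariety Z ->
  f \is d.-homog -> p \is e.-homog -> ~ vanishing_ideal Z f ->
  vanishing_ideal Z (f * p) -> vanishing_ideal Z p.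
Proof.
move=> [[S [_ ZE]] [_ Zirr]] fh ph fZ fpZ.
have nz x : Z x -> exists i, x i != 0 by rewrite ZE => -[].
have [||x Zx|Zf|Zp] := Zirr (zero_locus [set f]) (zero_locus [set p]).
- exact: proj_closed_locus fh.
- exact: proj_closed_locus ph.
- have /eqP := fpZ x Zx; rewrite mevalM mulf_eq0 => /orP[] /eqP x0.
    by left; split; [exact: nz | move=> _ ->].
  by right; split; [exact: nz | move=> _ ->].
- by case: fZ => x /Zf[_]; exact.
- by move=> x /Zp[_]; exact.
Qed.

Lemma proj_closed_neq0 V x : proj_closed V -> V x -> exists i, x i != 0.
Proof. by move=> [S [_ ->]] []. Qed.

Lemma separating_form Z' Z : proj_closed Z' -> proj_closed Z -> Z' `<` Z ->
  exists d f, [/\ (0 < d)%N, f \is d.-homog, vanishing_ideal Z' f &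
    ~ vanishing_ideal Z f].
Proof.
move=> [S [Shom ZE]] Zcl [_ nsub].
have [z Zz nZ'z] : exists2 z, Z z & ~ Z' z.
  apply: contrapT => nex; apply: nsub => z Zz; apply: contrapT => nZ'z.
  by apply: nex; exists z.
have [i zi] := proj_closed_neq0 Zcl Zz.
have [p Sp pz] : exists2 p, S p & p.@[z] != 0.
  apply: contrapT => nex; apply: nZ'z; rewrite ZE; split; first by exists i.
  move=> p Sp; apply: contrapT => /eqP pz; apply: nex; by exists p.
have [d ph] := Shom p Sp.
(* the variable makes the degree positive, whatever the degree of p *)
exists d.+1, ('X_i * p); split=> //.
- exact: (dhomogM (homog_var K i) ph).
- by move=> x; rewrite ZE => -[_ xS]; rewrite mevalM (xS p Sp) mulr0.
- move=> /(_ z Zz)/eqP; rewrite mevalM mevalXU mulf_eq0.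
  by rewrite (negPf zi) (negPf pz).
Qed.

(** In the coordinate ring of [Z m.+1] a form that vanishes on [Z m] but not on
    [Z m.+1] is a nonzerodivisor: its multiples form a shifted copy of the
    ring, and the quotient by them still maps onto the coordinate ring of
    [Z m]. *)
Lemma chain_growth (Z : nat -> set ('I_n.+1 -> K)) m :
  (forall i, (i <= m)%N -> proj_subvariety (Z i)) ->
  (forall i, (i < m)%N -> Z i `<` Z i.+1) ->
  growth_ge m.+1 (hilb (vanishing_forms (Z m))).
Proof.
elim: m => [|m IH] subvar lt.
  apply: growth_ge_pos => e; have [cl [ne _]] := subvar 0%N isT.
  exact: hilb_vanishing_forms_gt0.
have svm := subvar m (leqnSn m); have svm1 := subvar m.+1 (leqnn _).
have [d [f [d0 fh fZ nfZ]]] := separating_form svm.1 svm1.1 (lt m (ltnSn m)).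
have IHm : growth_ge m.+1 (hilb (vanishing_forms (Z m))).
  by apply: IH => i im; [apply: subvar | apply: lt]; lia.
apply: growth_ge_step d0 _ _ IHm => e; last first.
  by apply: vanishing_forms_hilb_le; case: (lt m (ltnSn m)).
have reg : forall p : dhomog n.+1 K e,
    form_part (e + d) (f * val p) \in vanishing_forms (Z m.+1) (e + d)%N ->
    p \in vanishing_forms (Z m.+1) e.
  move=> p; rewrite -/(in_degree _ _ _) in_vanishing_forms; last first.
    by rewrite addnC; apply: dhomogM => //; exact: (valP p).
  rewrite mem_vanishing_forms => /asboolP fpZ; apply/asboolP.
  exact: (irreducible_nonzerodivisor svm1 fh (valP p) nfZ fpZ).
apply: leq_trans (hilb_adjoin_regular reg); rewrite leq_add2l.
apply: hilbS; apply/subvP => p /mem_adjoin[u uI [v vh ->]].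
rewrite addnK in vh; have fvh : f * v \is (e + d).-homog.
  by rewrite addnC; exact: dhomogM.
apply: rpredD.
  move: uI; rewrite !mem_vanishing_forms => /asboolP uZ; apply/asboolP => x Zx.
  by apply: uZ; case: (lt m (ltnSn m)) => + _; apply.
rewrite -/(in_degree _ _ _) in_vanishing_forms //; apply/asboolP => x Zx.
by rewrite mevalM fZ // mul0r.
Qed.

Definition adjoin_seq (I : family K n) d (fs : seq {mpoly K[n.+1]}) :=
  foldl (fun J f => adjoin J f d) I fs.

Lemma adjoin_seq_ideal I d fs : {in fs, forall f, f \is d.-homog} ->
  graded_ideal I -> graded_ideal (adjoin_seq I d fs).
Proof.
elim: fs I => //= f fs IH I fsh Iid; apply: IH.
  by move=> g gfs; apply: fsh; rewrite inE gfs orbT.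
by apply: adjoin_ideal => //; apply: fsh; rewrite mem_head.
Qed.

Lemma sub_adjoin_seq (I : family K n) d fs e : (I e <= adjoin_seq I d fs e)%VS.
Proof.
elim: fs I => //= f fs IH I.
exact: subv_trans (sub_adjoin _ _ _ _) (IH _).
Qed.

Lemma adjoin_seq_gen (I : family K n) d fs f :
  {in fs, forall f, f \is d.-homog} ->
  f \in fs -> in_degree (adjoin_seq I d fs) d f.
Proof.
elim: fs I => //= g fs IH I fsh; rewrite inE => /orP[/eqP ->|]; last first.
  by apply: IH => h hfs; apply: fsh; rewrite inE hfs orbT.
apply: (subvP (sub_adjoin_seq _ _ _ _)); apply: adjoin_gen.
by apply: fsh; rewrite mem_head.
Qed.

Lemma growth_le_adjoin_seq I d fs : (0 < d)%N -> graded_ideal I ->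
  {in fs, forall f, f \is d.-homog} ->
  growth_le 0 (hilb (adjoin_seq I d fs)) -> growth_le (size fs) (hilb I).
Proof.
move=> d0; elim: fs I => //= f fs IH I Iid fsh Hfs.
have fh : f \is d.-homog by apply: fsh; rewrite mem_head.
apply: (growth_le_step d0 _ (IH _ _ _ Hfs)).
- by move=> e; exact: hilb_adjoin_le.
- exact: adjoin_ideal.
- by move=> g gfs; apply: fsh; rewrite inE gfs orbT.
Qed.

End Dimension.

Section Intersection.
Variables (K : closedFieldType) (n : nat).
Implicit Types (V : set ('I_n.+1 -> K)).

(** If the forms and the ideal of the top [Z m] of the chain had no common zero,
    they would generate everything in large degrees, and [size fs] would be at
    least the growth exponent [m.+1] of [Z m]. *)
Lemma chain_common_zero V m d (fs : seq {mpoly K[n.+1]}) :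
  subvariety_chain V m -> (0 < d)%N -> {in fs, forall f, f \is d.-homog} ->
  (size fs <= m)%N -> exists2 x, V x & {in fs, forall f, f.@[x] = 0}.
Proof.
move=> [Z [Zsub Zlt]] d0 fsh sfs.
pose I := vanishing_forms (Z m).
have Iid : graded_ideal I by exact: vanishing_forms_ideal.
have grow : growth_ge m.+1 (hilb I).
  by apply: chain_growth => // i /Zsub[].
have Jid := adjoin_seq_ideal fsh Iid.
have [Jpos|] := pselect (forall e, (0 < hilb (adjoin_seq I d fs) e)%N); last first.
  move=> /existsNP[e0 /negP]; rewrite -eqn0Ngt => /eqP J0.
  have J0' : growth_le 0 (hilb (adjoin_seq I d fs)).
    by apply: (@growth_le_eventually0 _ e0) => e; exact: hilb_eq0_leq Jid J0.
  have := growth_le_ge (growth_le_adjoin_seq d0 Iid fsh J0') grow.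
  by rewrite ltnNge sfs.
have [a a0 aJ] := projective_Nullstellensatz Jid Jpos.
have [[[S [Shom ZE]] _] ZV] := Zsub m (leqnn m).
exists a; last by move=> f ffs; apply: (aJ d); [exact: fsh | exact: adjoin_seq_gen].
apply: ZV; rewrite ZE; split=> // p Sp; have [e ph] := Shom p Sp.
apply: (aJ e) => //; apply: (subvP (sub_adjoin_seq _ _ _ _)).
rewrite -/(in_degree _ _ _) in_vanishing_forms //; apply/asboolP => x.
by rewrite ZE => -[_]; exact.
Qed.

(** Modulo the ideal of V the forms are combinations of representatives of a
    basis of their span, and these are as many as the rank. *)
Lemma low_rank_common_zero V m d q (Q : 'I_q -> dhomog n.+1 K d) (S : {set 'I_q}) :
  subvariety_chain V m -> (0 < d)%N -> (rank_forms V Q S <= m)%N ->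
  exists2 x, V x & forall i, i \in S -> (val (Q i)).@[x] = 0.
Proof.
move=> chain d0; rewrite /rank_forms; set U := <<_>>%VS => rk.
pose b := vbasis U.
pose fs := [seq val (repr b`_i : dhomog n.+1 K d) | i : 'I_(\dim U)].
have [||x Vx x0] := chain_common_zero (fs := fs) chain d0.
- by move=> f /mapP[i _ ->]; exact: valP.
- by rewrite size_image card_ord.
exists x => // i iS.
have QU : form_class V (Q i) \in U.
  by apply/memv_span/map_f; rewrite mem_enum.
have := coord_vbasis QU; set c := coord _ => QE.
have : Q i - \sum_(j < \dim U) c j (form_class V (Q i)) *: repr b`_j
    \in vanishing_forms V d.
  apply/vquot_eqP; rewrite -/(form_class V (Q i)) {1}QE.
  rewrite linear_sum; apply: eq_bigr => j _.
  by rewrite linearZ /= vquot_reprK.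
rewrite mem_vanishing_forms => /asboolP/(_ x Vx)/eqP.
rewrite raddfB subr_eq0 => /eqP QxE; apply: (etrans QxE).
rewrite !raddf_sum big1 // => j _ /=.
by rewrite mevalZ x0 ?mulr0 //; apply/mapP; exists j; rewrite ?mem_enum.
Qed.

End Intersection.

(** * Weights and greedy bases for submodular rank functions *)

Section Matroid.
Import mathcomp.boot.fintype mathcomp.boot.finset.
Local Open Scope set_scope.
Local Open Scope ring_scope.
Variables (T : finType) (rho : {set T} -> nat).
Implicit Types (A B S : {set T}).

Definition rank_function : Prop :=
  [/\ forall A B, A \subset B -> (rho A <= rho B)%N,
      forall A B, (rho (A :|: B) + rho (A :&: B) <= rho A + rho B)%N
    & forall A, (rho A <= #|A|)%N].

Hypothesis rhoP : rank_function.

Let rhoS A B : A \subset B -> (rho A <= rho B)%N.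
Proof. by case: rhoP => + _ _; apply. Qed.

Let rho_submod A B : (rho (A :|: B) + rho (A :&: B) <= rho A + rho B)%N.
Proof. by case: rhoP => _ + _; apply. Qed.

Let rho_card A : (rho A <= #|A|)%N.
Proof. by case: rhoP => _ _; apply. Qed.

Let rho0 : rho set0 = 0%N.
Proof. by apply/eqP; rewrite -leqn0 -(cards0 T). Qed.

(** Remove an element [x] of least value and compare the sums relative to
    [L x]: what is left over is the weight of [S] against the size of the basis,
    both times [L x - l].  The shift [l] is kept free for that induction. *)
Lemma greedy_basis (R : realFieldType) (w L : T -> R) S :
  (forall A, A \subset S -> \sum_(j in A) w j <= (rho A)%:R) ->
  exists B, [/\ B \subset S, #|B| = rho S, rho B = rho S &
    forall l, (forall j, j \in S -> l <= L j) ->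
      \sum_(j in S) w j * (L j - l) <= \sum_(j in B) (L j - l)].
Proof.
have [m] := ubnP #|S|; elim: m S => // m IH S; rewrite ltnS => Sm wS.
have [->|/set0Pn[x0 x0S]] := eqVneq S set0.
  by exists set0; split; rewrite ?cards0 ?rho0 // => l _; rewrite !big_set0.
have [x xS xmin] := arg_minP L x0S; have {}xS : x \in S by [].
have [||B [BS cB rB HB]] := IH (S :\ x).
- have := cardsD1 x S; rewrite xS => cS; lia.
- by move=> A AS; apply: wS; apply: subset_trans AS (subsetDl _ _).
have xB : x \notin B.
  by apply/negP => /(subsetP BS); rewrite !inE eqxx.
have BS' : B \subset S := subset_trans BS (subsetDl _ _).
have step (B' : {set T}) : #|B'| = rho S ->
    \sum_(j in B) (L j - L x) = \sum_(j in B') (L j - L x) ->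
    forall l, (forall j, j \in S -> l <= L j) ->
      \sum_(j in S) w j * (L j - l) <= \sum_(j in B') (L j - l).
  move=> cB' sB' l lS.
  have -> : \sum_(j in S) w j * (L j - l)
      = \sum_(j in S :\ x) w j * (L j - L x) + (\sum_(j in S) w j) * (L x - l).
    rewrite mulr_suml (big_setD1 x xS) /= [X in _ = _ + X](big_setD1 x xS) /=.
    rewrite addrCA -big_split /=; congr (_ + _); apply: eq_bigr => j _; ring.
  have -> : \sum_(j in B') (L j - l)
      = \sum_(j in B') (L j - L x) + (#|B'|)%:R * (L x - l).
    rewrite mulr_natl -sumr_const -big_split /=; apply: eq_bigr => j _; ring.
  rewrite -sB'; apply: lerD.
    by apply: HB => j; rewrite inE => /andP[_ jS]; exact: xmin.
  rewrite cB' ler_wpM2r ?subr_ge0 ?lS //; exact: wS.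
have [rE|rN] := eqVneq (rho (S :\ x)) (rho S).
  by exists B; split=> //; rewrite ?cB ?rB //; apply: step => //; rewrite cB.
have rlt : (rho (S :\ x) < rho S)%N by rewrite ltn_neqAle rN rhoS // subsetDl.
have := rho_submod (x |: B) (S :\ x).
have -> : (x |: B) :|: (S :\ x) = S.
  apply/setP => y; rewrite !inE; have [->|] := eqVneq y x; first by rewrite xS.
  have [yB|] //= := boolP (y \in B); by rewrite (subsetP BS').
have -> : (x |: B) :&: (S :\ x) = B.
  apply/setP => y; rewrite !inE; have [->|_] := eqVneq y x.
    by rewrite (negPf xB).
  by have [yB|] //= := boolP (y \in B); rewrite (subsetP BS').
rewrite rB leq_add2r => rS.
have sub : x |: B \subset S by rewrite subUset sub1set xS.
have cxB : #|x |: B| = (rho (S :\ x)).+1 by rewrite cardsU1 xB cB.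
have r1 : (rho (x |: B) <= #|x |: B|)%N := rho_card _.
have r2 := rhoS sub.
exists (x |: B); split=> //; try lia.
by apply: step; [lia | rewrite big_setU1 //= subrr add0r].
Qed.

Definition extend_weight (T0 : {set T}) (w : T -> rat) (c : rat) x :=
  if x \in T0 then w x else c.

Lemma sum_extend_weight T0 w c A :
  \sum_(x in A) extend_weight T0 w c x
    = \sum_(x in A :&: T0) w x + c * (#|A :|: T0|%:R - #|T0|%:R).
Proof.
rewrite (big_setID T0) /=; congr (_ + _).
  by apply: eq_bigr => x; rewrite inE /extend_weight => /andP[_ ->].
rewrite (eq_bigr (fun=> c)); last first.
  by move=> x; rewrite inE /extend_weight => /andP[/negPf-> _].
rewrite sumr_const -[LHS]mulr_natr; congr (_ * _).
by apply/eqP; rewrite eq_sym subr_eq -natrD cardsD cardsU; apply/eqP; congr _%:R;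
  have := subset_leq_card (subsetIl A T0); lia.
Qed.

(** By submodularity the rank gained by passing from [T0] to [A :|: T0] is at
    most the one gained by passing from [A :&: T0] to [A]. *)
Lemma sum_extend_weight_le T0 w c A :
  \sum_(x in A :&: T0) w x <= (rho (A :&: T0))%:R ->
  c * (#|A :|: T0|%:R - #|T0|%:R) <= (rho (A :|: T0))%:R - (rho T0)%:R ->
  \sum_(x in A) extend_weight T0 w c x <= (rho A)%:R.
Proof.
move=> h1 h2; rewrite sum_extend_weight.
have : (rho (A :|: T0))%:R + (rho (A :&: T0))%:R <= (rho A)%:R + (rho T0)%:R :> rat.
  by rewrite -!natrD ler_nat.
lra.
Qed.

Hypothesis loopless : forall x, (0 < rho [set x])%N.

Let rho_gt0 A : A != set0 -> (0 < rho A)%N.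
Proof.
by move=> /set0Pn[x xA]; apply: leq_trans (loopless x) (rhoS _); rewrite sub1set.
Qed.

(** The hypothesis says that [c] is at least every slope from a subset of [T0] to
    [T0].  Let [T1] attain the largest slope; that slope is the weight of
    the elements outside [T1], and the slopes of the subsets of [T1] towards
    [T1] cannot exceed it, so that the construction can be repeated on
    [T1]. *)
Lemma fractional_base (T0 : {set T}) (c : rat) :
  (forall A, A \subset T0 ->
     (rho T0)%:R - (rho A)%:R <= c * (#|T0|%:R - #|A|%:R)) ->
  exists w : T -> rat,
    [/\ forall x, x \in T0 -> 0 < w x <= c,
        \sum_(x in T0) w x = (rho T0)%:R
      & forall A, A \subset T0 -> \sum_(x in A) w x <= (rho A)%:R].
Proof.
have [m] := ubnP #|T0|; elim: m T0 c => // m IH T0 c; rewrite ltnS => Tm cT.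
have [->|T0n] := eqVneq T0 set0.
  exists (fun=> 0); split=> [x||A _]; by rewrite ?inE // ?big_set0 ?rho0 // big1.
pose slope A : rat := ((rho T0)%:R - (rho A)%:R) / (#|T0|%:R - #|A|%:R).
have prop0 : set0 \proper T0 by rewrite properEneq eq_sym T0n sub0set.
have [T1 T1T0 T1max] :=
  @arg_maxP _ _ _ _ (fun A => A \proper T0) slope prop0.
set c1 := slope T1 in T1max.
have dpos A : A \proper T0 -> 0 < #|T0|%:R - #|A|%:R :> rat.
  by move=> /proper_card lt; rewrite subr_gt0 ltr_nat.
have c1A A : A \subset T0 -> (rho T0)%:R - (rho A)%:R <= c1 * (#|T0|%:R - #|A|%:R).
  rewrite subEproper => /orP[/eqP->|AT0]; first by rewrite !subrr mulr0.
  by rewrite -ler_pdivrMr ?dpos //; exact: T1max.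
have c1E : (rho T0)%:R - (rho T1)%:R = c1 * (#|T0|%:R - #|T1|%:R).
  by rewrite divfK // gt_eqF // dpos.
have c1c : c1 <= c by rewrite ler_pdivrMr ?dpos // cT // proper_sub.
have c10 : 0 < c1.
  have := c1A _ (sub0set T0); rewrite cards0 rho0 !subr0 => h.
  have := rho_gt0 T0n; rewrite -(ltr_nat rat) => h0.
  have := lt_le_trans h0 h; rewrite pmulr_lgt0 // ltr0n card_gt0 //.
have [||w [wT1 sT1 wA]] := IH T1 c1.
- by apply: leq_trans Tm; exact: proper_card.
- by move=> A AT1; have := c1A A (subset_trans AT1 (proper_sub T1T0)); lra.
exists (extend_weight T1 w c1); split=> [x xT0||A AT0].
- rewrite /extend_weight; case: ifP => [/wT1/andP[-> h]|_]; last by rewrite c10.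
  exact: le_trans h c1c.
- rewrite sum_extend_weight (setIidPr (proper_sub T1T0)) sT1.
  rewrite (setUidPl (proper_sub T1T0)).
  by rewrite -c1E; ring.
- apply: sum_extend_weight_le; first by apply: wA; exact: subsetIr.
  have := c1A (A :|: T1); rewrite subUset AT0 proper_sub // => /(_ isT); lra.
Qed.

Variables (k N : nat).
Hypothesis k0 : (0 < k)%N.
Hypothesis kN : (k <= N)%N.
Hypothesis rho_le : forall A, (rho A <= k.+1)%N.
Hypothesis rho_big : forall A, #|A| = N.+1 -> rho A = k.+1.
Hypothesis cardT : (2 * N + 1 < #|T| + k)%N.

Let rho_full A : (N < #|A|)%N -> rho A = k.+1.
Proof.
move=> AN; apply/eqP; rewrite eqn_leq rho_le /=.
have [t] := ubnP (#|A| - N.+1)%N; elim: t A AN => // t IH A.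
rewrite leq_eqVlt => /orP[/eqP/esym cA|AN] tA; first by rewrite rho_big.
have /set0Pn[x xA] : A != set0 by rewrite -card_gt0; lia.
have cA := cardsD1 x A; rewrite xA in cA.
by apply: leq_trans (rhoS (subsetDl A [set x])); apply: IH; lia.
Qed.

(** The weight [c] is the largest slope from [(#|A|, rho A)], [#|A| <= N], to
    [(2N - k + 1, k + 1)], attained at [T0]; the empty set gives its lower bound.
    For the rank bound at [A], either [A :|: T0] is small enough to compete in
    the definition of [c], or it has full rank; then [A] has rank at least
    [k + 1 - rho T0], and already [c * #|A|] is at most [rho A]. *)
Lemma nochka_weights : exists (w : T -> rat) (c : rat),
  [/\ (forall x, 0 < w x <= c) /\ (exists x, w x = c),
      \sum_x w x = c * (#|T|%:R - 2 * N%:R + k%:R - 1) + k%:R + 1,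
      (k%:R + 1) / (2 * N%:R - k%:R + 1) <= c <= k%:R / N%:R
    & forall A, (#|A| <= N.+1)%N -> \sum_(x in A) w x <= (rho A)%:R].
Proof.
pose m : rat := 2 * N%:R - k%:R + 1.
pose slope A : rat := (k%:R + 1 - (rho A)%:R) / (m - #|A|%:R).
have kN' : k%:R <= N%:R :> rat by rewrite ler_nat.
have k0' : 1 <= k%:R :> rat by rewrite (ler_nat _ 1).
have dpos A : (#|A| <= N)%N -> 0 < m - #|A|%:R.
  by rewrite -(ler_nat rat) /m; lra.
have prop0 : (#|(set0 : {set T})| <= N)%N by rewrite cards0.
have [T0 T0N T0max] :=
  @arg_maxP _ _ _ _ (fun A => #|A| <= N)%N slope prop0.
set c := slope T0 in T0max.
have cA A : (#|A| <= N)%N -> k%:R + 1 - (rho A)%:R <= c * (m - #|A|%:R).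
  by move=> AN; rewrite -ler_pdivrMr ?dpos //; exact: T0max.
have cE : k%:R + 1 - (rho T0)%:R = c * (m - #|T0|%:R).
  by rewrite divfK // gt_eqF // dpos.
have cm : k%:R + 1 <= c * m by have := cA _ prop0; rewrite cards0 rho0 !subr0.
have m0 : 0 < m by have := dpos _ prop0; rewrite cards0 subr0.
have c0 : 0 < c by have : 0 < c * m; [lra | rewrite pmulr_lgt0].
have c1 : c * N%:R <= k%:R -> c <= 1 by nra.
(* one element raises the rank by at most one, and N + 1 elements have full
   rank *)
have defect A : (#|A| <= N.+1)%N -> (#|A| + k <= N + rho A)%N.
  have [t] := ubnP (N.+1 - #|A|); elim: t A => // t IH A tA.
  rewrite leq_eqVlt => /orP[/eqP cA1|AN]; first by rewrite rho_big // cA1; lia.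
  have [x xA] : exists x, x \notin A.
    apply/existsP; rewrite -negb_forall; apply/negP => /forallP allA.
    have : (#|T| <= #|A|)%N by apply/subset_leq_card/subsetP => x _; exact: allA.
    lia.
  have cx : #|x |: A| = #|A|.+1 by rewrite cardsU1 xA.
  have := IH (x |: A); rewrite cx.
  have := rho_submod [set x] A; have := rho_card [set x]; rewrite cards1; lia.
have defect' A : (#|A| <= N.+1)%N -> #|A|%:R + k%:R <= N%:R + (rho A)%:R :> rat.
  by move=> /defect; rewrite -!natrD ler_nat.
have T0N' : (#|T0| <= N.+1)%N by exact: leqW.
have rT0 : (rho T0)%:R <= k%:R + 1 :> rat.
  by rewrite -[1]/(1%:R) -natrD ler_nat addn1.
have cdef : c * (N%:R + 1 - (rho T0)%:R) <= k%:R + 1 - (rho T0)%:R.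
  by rewrite cE ler_pM2l //; have := defect' _ T0N'; rewrite /m; lra.
have cN : c * N%:R <= k%:R.
  (* c N <= k reduces to (N - k)(k - 1) >= 0, or to (N - k)(rho T0 - 1) >= 0 *)
  have [T0e|T0n] := eqVneq T0 set0.
    have cmE : c * m = k%:R + 1 by have := cE; rewrite T0e cards0 rho0 !subr0.
    have h : 0 <= (N%:R - k%:R) * (k%:R - 1) :> rat by apply: mulr_ge0; lra.
    rewrite -(ler_pM2r m0) mulrAC cmE /m; nra.
  have r1 : 1 <= (rho T0)%:R :> rat by rewrite (ler_nat _ 1) rho_gt0.
  have rk : (rho T0)%:R < k%:R + 1 :> rat.
    have : 0 < c * (m - #|T0|%:R) by rewrite mulr_gt0 // dpos.
    by rewrite -cE; lra.
  have h : 0 <= (N%:R - k%:R) * ((rho T0)%:R - 1) :> rat by apply: mulr_ge0; lra.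
  have pos : 0 < N%:R + 1 - (rho T0)%:R :> rat by lra.
  rewrite -(ler_pM2r pos) mulrAC.
  have : c * (N%:R + 1 - (rho T0)%:R) * N%:R <= (k%:R + 1 - (rho T0)%:R) * N%:R.
    by rewrite ler_wpM2r //; lra.
  nra.
have {}c1 := c1 cN.
have [w [wT0 sT0 wA]] : exists w : T -> rat,
    [/\ forall x, x \in T0 -> 0 < w x <= c,
        \sum_(x in T0) w x = (rho T0)%:R
      & forall A, A \subset T0 -> \sum_(x in A) w x <= (rho A)%:R].
  apply: fractional_base => A AT0.
  have := cA A (leq_trans (subset_leq_card AT0) T0N); lra.
have wc x : 0 < extend_weight T0 w c x <= c.
  by rewrite /extend_weight; case: ifP => [/wT0 //|_]; rewrite c0 lexx.
exists (extend_weight T0 w c), c; split.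
- split=> //; have [x xT0] : exists x, x \notin T0.
    apply/existsP; rewrite -negb_forall; apply/negP => /forallP allA.
    have : (#|T| <= #|T0|)%N by apply/subset_leq_card/subsetP => x _; exact: allA.
    lia.
  by exists x; rewrite /extend_weight (negPf xT0).
- have -> : \sum_x extend_weight T0 w c x
      = \sum_(x in [set: T]) extend_weight T0 w c x.
    by apply: eq_bigl => x; rewrite inE.
  rewrite sum_extend_weight setTI setTU cardsT sT0; move: cE; rewrite /m; lra.
- apply/andP; split; first by rewrite ler_pdivrMr.
  by rewrite ler_pdivlMr //; lra.
move=> A AN.
have [full|nfull] := eqVneq (rho (A :|: T0)) k.+1; last first.
  apply: sum_extend_weight_le; first by apply: wA; exact: subsetIr.
  have UN : (#|A :|: T0| <= N)%N.
    by rewrite leqNgt; apply: contra nfull => UN; rewrite rho_full.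
  by have := cA _ UN; lra.
(* full rank: #|A| <= N - k + rho A, and cdef bounds c on the part of rank
   k + 1 - rho T0, c <= 1 on the rest *)
apply: (@le_trans _ _ (c * #|A|%:R)).
  rewrite mulr_natr -sumr_const; apply: ler_sum => x _.
  by case/andP: (wc x).
have := rho_submod A T0; rewrite full => /(leq_trans (leq_addr _ _)).
rewrite -(ler_nat rat) natrD -addn1 natrD => rAT.
have := defect' _ AN => dA.
have : c * #|A|%:R <= c * (N%:R - k%:R + (rho A)%:R) by rewrite ler_pM2l //; lra.
have : 0 <= (1 - c) * ((rho A)%:R - (k%:R + 1 - (rho T0)%:R)).
  by apply: mulr_ge0; lra.
nra.
Qed.
End Matroid.

(** * Rank of forms, and the theorem *)

Section RankOfForms.
Import mathcomp.boot.fintype mathcomp.boot.finset.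
Variables (K : fieldType) (n d q : nat).
Variables (V : set ('I_n.+1 -> K)) (Q : 'I_q -> dhomog n.+1 K d).
Implicit Types (A B : {set 'I_q}).

Let span_of A : {vspace (quot_forms V d)} :=
  <<[seq form_class V (Q i) | i <- enum A]>>%VS.

Let span_ofS A B : A \subset B -> (span_of A <= span_of B)%VS.
Proof.
move=> /subsetP AB; apply: sub_span => v /mapP[i iA ->]; apply: map_f.
by move: iA; rewrite !mem_enum => /AB.
Qed.

Lemma rank_forms_le_card A : (rank_forms V Q A <= #|A|)%N.
Proof. by apply: leq_trans (dim_span _) _; rewrite size_map -cardE. Qed.

(** The truncation is needed because N + 1 forms may have rank above k + 1,
    while the weights require full rank to be exactly k + 1. *)
Lemma rank_forms_truncated_rank_function k :
  rank_function (fun A => minn k (rank_forms V Q A)).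
Proof.
have rkS A B : A \subset B -> (rank_forms V Q A <= rank_forms V Q B)%N.
  by move=> AB; apply/dimvS/span_ofS.
split=> [A B /rkS|A B|A]; first by lia.
  have spanU : span_of (A :|: B) = (span_of A + span_of B)%VS.
    rewrite -span_cat; apply: eq_span => v; rewrite mem_cat.
    apply/mapP/orP => [[i + ->]|].
      rewrite mem_enum inE => /orP[iA|iB]; [left|right]; apply: map_f;
      by rewrite mem_enum.
    by case=> /mapP[i + ->]; rewrite mem_enum => iA; exists i => //;
      rewrite mem_enum inE iA ?orbT.
  have := dimv_sum_cap (span_of A) (span_of B); rewrite -spanU.
  have : (\dim (span_of (A :&: B)) <= \dim (span_of A :&: span_of B))%N.
    by apply: dimvS; rewrite subv_cap !span_ofS ?subsetIl ?subsetIr.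
  have := rkS _ _ (subsetUl A B); have := rkS _ _ (subsetUr A B).
  rewrite -![rank_forms _ _ _]/(\dim (span_of _)).
  lia.
by rewrite geq_min rank_forms_le_card orbT.
Qed.

Lemma rank_forms1_gt0 j : proj_closed V -> ~ V `<=` hypersurface (Q j) ->
  (0 < rank_forms V Q [set j]%SET)%N.
Proof.
move=> Vcl VQ; rewrite /rank_forms enum_set1 /= span_seq1 dim_vline lt0b.
apply: contra_notN VQ => /eqP Q0 x Vx; split; first exact: proj_closed_neq0 Vx.
move=> _ ->; have : Q j - 0 \in vanishing_forms V d.
  by apply/vquot_eqP; rewrite linear0.
by rewrite subr0 mem_vanishing_forms => /asboolP; apply.
Qed.

End RankOfForms.

Lemma full_rank_of_empty_intersection (K : closedFieldType) (n k d q : nat)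
    (V : set ('I_n.+1 -> K)) (Q : 'I_q -> dhomog n.+1 K d) (S : {set 'I_q}) :
  proj_closed V -> subvariety_chain V k -> (0 < d)%N ->
  V `&` \bigcap_(i in [set` S]) hypersurface (Q i) = set0 ->
  (k < rank_forms V Q S)%N.
Proof.
move=> Vcl chain d0 VS0; rewrite ltnNge; apply/negP => rk.
have [x Vx xS] := low_rank_common_zero chain d0 rk.
suff : (V `&` \bigcap_(i in [set` S]) hypersurface (Q i)) x by rewrite VS0.
split=> // i iS; split; first exact: proj_closed_neq0 Vx.
by move=> _ ->; exact: xS.
Qed.

Lemma powR_prod_expR (R : realType) (T : finType) (S : {set T}) (E w : T -> R) :
  (forall j, 0 < E j) ->
  \prod_(j in S) E j `^ w j = sequences.expR (\sum_(j in S) w j * ln (E j)).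
Proof.
by move=> E0; rewrite expR_sum; apply: eq_bigr => j _; rewrite /powR gt_eqF.
Qed.

Theorem lemma9 (R : realType) (n k N q d : nat)
    (V : set ('I_n.+1 -> R[i])) (Q : 'I_q -> dhomog n.+1 R[i] d) :
  (k <= n)%N ->
  (0 < k)%N ->
  proj_subvariety V ->
  proj_dim_eq V k ->
  (0 < d)%N ->
  (forall j, Q j != 0) ->
  (forall j, ~ V `<=` hypersurface (Q j)) ->
  2 * N%:Z - k%:Z + 1 < q%:Z ->
  subgeneral_position N k V Q ->
  exists w : 'I_q -> rat,
    let wmax := \big[Num.max/0]_(j < q) w j in
    [/\ forall j, 0 < w j <= 1,
        \sum_(j < q) w j
          = wmax * (q%:R - 2 * N%:R + k%:R - 1) + k%:R + 1,
        (k%:R + 1) / (2 * N%:R - k%:R + 1) <= wmax <= k%:R / N%:R,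
        forall S : {set 'I_q}, #|S| = (N + 1)%N ->
          \sum_(j in S) w j <= k%:R + 1
      & forall E : 'I_q -> R, (forall j, 1 <= E j) ->
        forall S : {set 'I_q}, #|S| = (N + 1)%N ->
        exists So : {set 'I_q},
          [/\ So \subset S, #|So| = (k + 1)%N, rank_forms V Q So = (k + 1)%N
            & \prod_(j in S) (E j `^ ratr (w j)) <= \prod_(j in So) E j]].
Proof.
move=> _ k0 [Vcl Virr] [chain _] d0 _ VQ qN [kq subgen].
pose rho (A : {set 'I_q}) := minn k.+1 (rank_forms V Q A).
have rhoP : rank_function rho by exact: rank_forms_truncated_rank_function.
have rk_big (A : {set 'I_q}) : #|A| = N.+1 -> (k < rank_forms V Q A)%N.
  rewrite -addn1 => /subgen; exact: full_rank_of_empty_intersection.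
have rho_big (A : {set 'I_q}) : #|A| = N.+1 -> rho A = k.+1.
  by move=> /rk_big rkA; apply/minn_idPl.
have Nq : (N.+1 <= q)%N by lia.
have kN : (k <= N)%N.
  pose A : {set 'I_q} := [set widen_ord Nq i | i in 'I_N.+1]%SET.
  have cA : #|A| = N.+1.
    by rewrite card_imset ?card_ord // => i j /(congr1 val) /= /val_inj.
  have := rk_big A cA; have := rank_forms_le_card V Q A; lia.
have [|||w [c [[wc [j0 wj0]] sumw cbounds wrho]]] :=
    nochka_weights rhoP _ k0 kN _ rho_big.
- by move=> j; rewrite leq_min /= rank_forms1_gt0.
- by move=> A; exact: geq_minl.
- by rewrite card_ord; lia.
have wmaxE : \big[Num.max/0]_(j < q) w j = c.
  apply/eqP; rewrite eq_le; apply/andP; split.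
    apply: bigmax_le => [|j _]; last by case/andP: (wc j).
    by have /andP[/ltW] := wc j0; rewrite wj0.
  by rewrite -wj0; exact: le_bigmax.
have k0' : 1 <= k%:R :> rat by rewrite (ler_nat _ 1).
have kN' : k%:R <= N%:R :> rat by rewrite ler_nat.
have c1 : c <= 1.
  case/andP: cbounds => _ /le_trans; apply.
  by rewrite ler_pdivrMr ?mul1r //; lra.
exists w; rewrite wmaxE; split.
- by move=> j; case/andP: (wc j) => -> /le_trans ->.
- by rewrite sumw card_ord.
- exact: cbounds.
- move=> A /eqP; rewrite addn1 => /eqP cA.
  have := wrho A; rewrite cA => /(_ (leqnn _)).
  by rewrite rho_big // -addn1 natrD.
move=> E E1 S /eqP; rewrite addn1 => /eqP cS.
have [|B [BS cB rB HB]] := @greedy_basis _ _ rhoP R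
    (fun j => ratr (w j)) (fun j => ln (E j)) S.
  move=> A AS; rewrite -rmorph_sum /= -(ratr_nat R) ler_rat; apply: wrho.
  by rewrite -cS; exact: subset_leq_card.
exists B; rewrite rho_big // in cB rB; split=> //.
- by rewrite addn1.
- by have := rank_forms_le_card V Q B; move: rB; rewrite cB /rho; lia.
have E0 j : 0 < E j by apply: lt_le_trans (E1 j).
rewrite powR_prod_expR //.
have -> : \prod_(j in B) E j = sequences.expR (\sum_(j in B) ln (E j)).
  by rewrite expR_sum; apply: eq_bigr => j _; rewrite lnK // posrE.
rewrite ler_expR; have := HB 0.
under eq_bigr do rewrite subr0; under [in X in _ <= X]eq_bigr do rewrite subr0.
by apply => j _; exact: ln_ge0.
Qed.
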